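(* Let $w_1,w_2,w_3$ be any odd positive integers, let $n\ge 0$ be an integer and let $y_1,y_2\in\mathbb{Z}_p$. Then \begin{align*} &w_1^{n}\sum_{k=0}^{n}\binom{n}{k}E_{k,q^{w_1w_2}}(w_3y_1)\,w_3^{n-k}w_2^{k}\sum_{i=0}^{w_1-1}(-1)^{i}q^{w_2w_3i}E_{n-k,q^{w_1w_3}}\Big(w_2y_2+\frac{w_2}{w_1}i\Big)\\ =&\,w_1^{n}\sum_{k=0}^{n}\binom{n}{k}E_{k,q^{w_1w_3}}(w_2y_1)\,w_2^{n-k}w_3^{k}\sum_{i=0}^{w_1-1}(-1)^{i}q^{w_2w_3i}E_{n-k,q^{w_1w_2}}\Big(w_3y_2+\frac{w_3}{w_1}i\Big)\\ =&\,w_2^{n}\sum_{k=0}^{n}\binom{n}{k}E_{k,q^{w_1w_2}}(w_3y_1)\,w_3^{n-k}w_1^{k}\sum_{i=0}^{w_2-1}(-1)^{i}q^{w_1w_3i}E_{n-k,q^{w_2w_3}}\Big(w_1y_2+\frac{w_1}{w_2}i\Big)\\ =&\,w_2^{n}\sum_{k=0}^{n}\binom{n}{k}E_{k,q^{w_2w_3}}(w_1y_1)\,w_1^{n-k}w_3^{k}\sum_{i=0}^{w_2-1}(-1)^{i}q^{w_1w_3i}E_{n-k,q^{w_1w_2}}\Big(w_3y_2+\frac{w_3}{w_2}i\Big)\\ =&\,w_3^{n}\sum_{k=0}^{n}\binom{n}{k}E_{k,q^{w_1w_3}}(w_2y_1)\,w_2^{n-k}w_1^{k}\sum_{i=0}^{w_3-1}(-1)^{i}q^{w_1w_2i}E_{n-k,q^{w_2w_3}}\Big(w_1y_2+\frac{w_1}{w_3}i\Big)\\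 =&\,w_3^{n}\sum_{k=0}^{n}\binom{n}{k}E_{k,q^{w_2w_3}}(w_1y_1)\,w_1^{n-k}w_2^{k}\sum_{i=0}^{w_3-1}(-1)^{i}q^{w_1w_2i}E_{n-k,q^{w_1w_3}}\Big(w_2y_2+\frac{w_2}{w_3}i\Big). \end{align*}
   Context: Let $p$ be a fixed odd prime, $\mathbb{C}_p$ the completion of an algebraic closure of $\mathbb{Q}_p$ with absolute value normalized by $|p|_p=1/p$, and let $q\in\mathbb{C}_p$ be fixed with $|q-1|_p<p^{-1/(p-1)}$. For $r\in\mathbb{C}_p$ with $|r-1|_p<p^{-1/(p-1)}$ (in particular for $r=q^w$, $w$ a positive integer), the $r$-Euler polynomials $E_{n,r}(x)$ ($n\ge 0$) are the polynomials in $x$ defined by the generating function $$\frac{2}{re^{t}+1}e^{xt}=\sum_{n=0}^{\infty}E_{n,r}(x)\frac{t^n}{n!}.$$ *)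

(* Defs.v *)
From HB Require Import structures.
From mathcomp Require Import all_boot all_order all_algebra.
From mathcomp Require Import reals exp.

Set Implicit Arguments.
Unset Strict Implicit.
Unset Printing Implicit Defensive.

Import Order.TTheory GRing.Theory Num.Theory.

Local Open Scope ring_scope.

Definition nonarch_abs (R : realType) (K : fieldType) (abs : K -> R) : Prop :=
  [/\ forall x, 0 <= abs x,
      forall x, abs x = 0 <-> x = 0,
      forall x y, abs (x * y) = abs x * abs y
    & forall x y, abs (x + y) <= Num.max (abs x) (abs y)].

Definition abs_complete (R : realType) (K : fieldType) (abs : K -> R) : Prop :=
  forall u : nat -> K,
    (forall e : R, 0 < e -> exists N : nat, forall m n : nat,
       (N <= m)%N -> (N <= n)%N -> abs (u m - u n) < e) ->
    exists l : K, forall e : R, 0 < e -> exists N : nat, forall n : nat,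
       (N <= n)%N -> abs (u n - l) < e.

Definition is_completion (R : realType) (K L : fieldType)
    (absK : K -> R) (absL : L -> R) (f : K -> L) : Prop :=
  [/\ forall x, absL (f x) = absK x,
      forall (y : L) (e : R), 0 < e -> exists x : K, absL (y - f x) < e
    & abs_complete absL].

Definition is_algebraic_closure (K L : fieldType) (f : K -> L) : Prop :=
  GRing.closed_field_axiom L /\ forall x : L, algebraicOver f x.

(* |x|_p = p ^ (- v_p(x)) with v_p(x) = v_p(numq x) - v_p(denq x). *)
Definition padic_abs (R : realType) (p : nat) (x : rat) : R :=
  if x == 0 then 0
  else p%:R ^ ((logn p `|denq x|%N)%:Z - (logn p `|numq x|%N)%:Z).

(* The tower Q -> Q_p -> algebraic closure of Q_p -> C_p; all its members are
   determined by these axioms up to isometric isomorphism. *)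
Record padicComplex (R : realType) (p : nat) := PadicComplex {
  Qp : fieldType;
  absQp : Qp -> R;
  rat_to_Qp : {rmorphism rat -> Qp};
  absQpP : nonarch_abs absQp;
  Qp_completion : is_completion (padic_abs R p) absQp rat_to_Qp;

  Qpbar : fieldType;
  absQpbar : Qpbar -> R;
  Qp_to_Qpbar : {rmorphism Qp -> Qpbar};
  absQpbarP : nonarch_abs absQpbar;
  Qpbar_closure : is_algebraic_closure Qp_to_Qpbar;
  absQpbar_ext : forall x, absQpbar (Qp_to_Qpbar x) = absQp x;

  Cp : fieldType;
  absCp : Cp -> R;
  Qpbar_to_Cp : {rmorphism Qpbar -> Cp};
  absCpP : nonarch_abs absCp;
  Cp_completion : is_completion absQpbar absCp Qpbar_to_Cp
}.

Definition Qp_to_Cp (R : realType) (p : nat) (C : padicComplex R p)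
  (x : Qp C) : Cp C := Qpbar_to_Cp C (Qp_to_Qpbar C x).

Definition in_Zp (R : realType) (p : nat) (C : padicComplex R p) (y : Cp C) :
    Prop :=
  exists2 x : Qp C, absQp x <= 1 & y = Qp_to_Cp x.

(* A formal power series in t is encoded by its coefficient sequence. *)

Section FPS.
Variable A : comUnitRingType.
Implicit Types a b : nat -> A.

Definition fps_const (c : A) : nat -> A := fun n => if n is 0%N then c else 0.
Definition fps_add a b : nat -> A := fun n => a n + b n.
Definition fps_mul a b : nat -> A := fun n => \sum_(i < n.+1) a i * b (n - i)%N.

(* e^{ct} *)
Definition fps_exp (c : A) : nat -> A := fun n => c ^+ n / n`!%:R.

(* The first n coefficients of 1/a, computed by
   b_n = ([n = 0] - \sum_(i < n) b_i a_(n-i)) / a_0. *)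
Fixpoint fps_inv_seq a (n : nat) : seq A :=
  if n is m.+1 then
    let s := fps_inv_seq a m in
    rcons s (((m == 0%N)%:R - \sum_(i < m) s`_i * a (m - i)%N) / a 0%N)
  else [::].

Definition fps_inv a : nat -> A := fun n => (fps_inv_seq a n.+1)`_n.

Lemma size_fps_inv_seq a n : size (fps_inv_seq a n) = n.
Proof. by elim: n => //= n IHn; rewrite size_rcons IHn. Qed.

Lemma nth_fps_inv_seq a n i : (i < n)%N -> (fps_inv_seq a n)`_i = fps_inv a i.
Proof.
elim: n => // n IHn; rewrite ltnS leq_eqVlt => /orP[/eqP-> //|lt_in].
by rewrite /= nth_rcons size_fps_inv_seq lt_in IHn.
Qed.

Lemma fps_invE a n :
  fps_inv a n = ((n == 0%N)%:R - \sum_(i < n) fps_inv a i * a (n - i)%N) / a 0%N.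
Proof.
rewrite {1}/fps_inv /= nth_rcons size_fps_inv_seq ltnn eqxx.
by congr ((_ - _) / _); apply: eq_bigr => i _; rewrite nth_fps_inv_seq.
Qed.

Lemma fps_mulV a n :
  a 0%N \is a GRing.unit -> fps_mul (fps_inv a) a n = fps_const 1 n.
Proof.
move=> a0U; rewrite /fps_mul big_ord_recr /= subnn fps_invE divrK // addrC subrK.
by case: n.
Qed.

Let trunc n a : {poly A} := \poly_(i < n.+1) a i.

Let fps_mul_trunc a b m n : (m <= n)%N ->
  fps_mul a b m = (trunc n a * trunc n b)`_m.
Proof.
move=> le_mn; rewrite coefM; apply: eq_bigr => i _; rewrite !coef_poly.
rewrite !ltnS (leq_trans (leq_ord i) le_mn).
by rewrite (leq_trans (leq_subr _ _) le_mn).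
Qed.

Lemma fps_mulC a b n : fps_mul a b n = fps_mul b a n.
Proof. by rewrite !(@fps_mul_trunc _ _ n n) // mulrC. Qed.

Lemma eq_fps_mul a b a' b' n : (forall i, a i = a' i) ->
  (forall i, b i = b' i) -> fps_mul a b n = fps_mul a' b' n.
Proof. by move=> ea eb; apply: eq_bigr => i _; rewrite ea eb. Qed.

Lemma fps_mulA a b c n :
  fps_mul a (fps_mul b c) n = fps_mul (fps_mul a b) c n.
Proof.
transitivity (trunc n a * (trunc n b * trunc n c))`_n.
  rewrite coefM; apply: eq_bigr => i _.
  by rewrite coef_poly ltn_ord (@fps_mul_trunc _ _ _ n) // leq_subr.
rewrite mulrA coefM; apply: eq_bigr => i _.
by rewrite coef_poly ltnS leq_subr -fps_mul_trunc // leq_ord.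
Qed.

Lemma fps_mul1 a n : fps_mul (fps_const 1) a n = a n.
Proof.
rewrite /fps_mul big_ord_recl /= mul1r subn0 big1 ?addr0 // => i _.
by rewrite mul0r.
Qed.

End FPS.

(* 2 / (r e^t + 1) * e^{xt} in K[x][[t]]. *)
Definition euler_gf (K : fieldType) (r : K) : nat -> {poly K} :=
  fps_mul
    (fps_mul (fps_const 2)
       (fps_inv (fps_add (fps_mul (fps_const r%:P) (fps_exp 1)) (fps_const 1))))
    (fps_exp 'X).

Definition euler_poly (K : fieldType) (n : nat) (r : K) : {poly K} :=
  n`!%:R * euler_gf r n.

Definition euler_sum (K : fieldType) (q : K) (n a b c : nat) (y1 y2 : K) : K :=
  a%:R ^+ n * \sum_(k < n.+1)
    'C(n, k)%:R * (euler_poly k (q ^+ (a * b))).[c%:R * y1]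
    * c%:R ^+ (n - k) * b%:R ^+ k
    * \sum_(i < a) (-1) ^+ i * q ^+ (b * c * i)
        * (euler_poly (n - k) (q ^+ (a * c))).[b%:R * y2 + b%:R / a%:R * i%:R].


Lemma absCp_nat (R : realType) (p : nat) (C : padicComplex R p) n :
  absCp (n%:R : Cp C) = padic_abs R p n%:R.
Proof.
have [H1 _ _] := Qp_completion C; have [H2 _ _] := Cp_completion C.
rewrite -H1 -absQpbar_ext -H2.
by rewrite !rmorph_nat.
Qed.

Lemma absCp_p (R : realType) (p : nat) (C : padicComplex R p) :
  prime p -> absCp (p%:R : Cp C) = p%:R^-1.
Proof.
move=> p_pr; rewrite absCp_nat /padic_abs pnatr_eq0.
rewrite -[p == 0]negbK -lt0n prime_gt0 //=.
rewrite -[(p%:R : rat)]/((p%:Z)%:~R) denq_int numq_int /=.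
by rewrite logn1 -{3}(expn1 p) pfactorK.
Qed.

Lemma Cp_pchar0 (R : realType) (p : nat) (C : padicComplex R p) n :
  prime p -> (n.+1%:R : Cp C) != 0.
Proof.
move=> p_pr; apply/eqP => n0; have := absCp_nat C n.+1; rewrite n0.
have [_ /(_ 0)[_ ->] // _ _] := absCpP C.
rewrite /padic_abs pnatr_eq0 /= => /esym/eqP.
by rewrite expfz_eq0 pnatr_eq0 -[p == 0]negbK -lt0n prime_gt0 // andbF.
Qed.

Lemma Cp_add1_neq0 (R : realType) (p : nat) (C : padicComplex R p) (r : Cp C) :
  prime p -> odd p -> absCp (r - 1) < 1 -> r + 1 != 0.
Proof.
move=> p_pr p_odd; apply: contraTneq => /eqP; rewrite addr_eq0 => /eqP->.
have abs2 : absCp (2%:R : Cp C) = 1.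
  rewrite absCp_nat /padic_abs pnatr_eq0.
  rewrite -[(2%:R : rat)]/((2%:Z)%:~R) denq_int numq_int /= logn1.
  rewrite (_ : logn p 2 = 0%N) //; apply/eqP; rewrite logn_prime //.
  by rewrite eqb0; apply: contraTneq p_odd => ->.
have absN1 : absCp (-1 : Cp C) = 1.
  have [ge0 _ absM _] := absCpP C.
  have abs1 : absCp (1 : Cp C) = 1.
    have := absM 2%:R 1; rewrite mulr1 abs2 mul1r; exact: esym.
  have := absM (-1) (-1); rewrite mulrNN mulr1 abs1 => /esym/eqP.
  by rewrite -expr2 sqrp_eq1 // => /eqP.
have [_ _ absM _] := absCpP C.
by rewrite -opprD -mulN1r absM absN1 mul1r abs2 ltxx.
Qed.

Lemma euler_gfP (K : fieldType) (r : K) n :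
  (forall m, (m.+1%:R : K) != 0) -> r + 1 != 0 ->
  fps_mul (fps_add (fps_mul (fps_const r%:P) (fps_exp 1)) (fps_const 1))
    (fun n => euler_poly n r / n`!%:R) n
  = fps_mul (fps_const 2) (fps_exp 'X) n.
Proof.
move=> K0 r1; set D := fps_add _ _.
have factU m : (m`!%:R : {poly K}) \is a GRing.unit.
  rewrite poly_unitE -polyC_natr size_polyC coefC eqxx.
  by rewrite -(prednK (fact_gt0 m)) K0 unitfE K0.
have D0 : D 0%N \is a GRing.unit.
  rewrite /D /fps_add /fps_mul big_ord1 /= /fps_exp subn0 expr0 fact0 divr1 mulr1.
  by rewrite -polyCD poly_unitE size_polyC coefC eqxx r1 unitfE r1.
rewrite (@eq_fps_mul _ _ _ D (euler_gf r)) //; last first.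
  by move=> i; rewrite /euler_poly mulrC mulKr.
rewrite /euler_gf -/D fps_mulA; apply: eq_fps_mul => // i.
rewrite (@eq_fps_mul _ _ _ D (fps_mul (fps_inv D) (fps_const 2))) //; last first.
  by move=> j; rewrite fps_mulC.
rewrite fps_mulA fps_mulC -[LHS]/(fps_mul _ _ i).
rewrite (@eq_fps_mul _ _ _ (fps_const 2) (fps_const 1)) //; last first.
  by move=> j; rewrite fps_mulC fps_mulV.
by rewrite fps_mulC fps_mul1.
Qed.

(* Main.v *)
From HB Require Import structures.
Require Import Defs.
From mathcomp Require Import all_boot all_order all_algebra.
From mathcomp Require Import ring.
From mathcomp Require Import boolp.
From mathcomp Require Import reals exp.

Set Implicit Arguments.
Unset Strict Implicit.
Unset Printing Implicit Defensive.

Import Order.TTheory GRing.Theory Num.Theory.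
Local Open Scope ring_scope.

(** Put [D m = q^m e^(m t) + 1].  The [n]-th sum attached to [(a, b, c)] is [n!] times
    the coefficient of [t^n] in the product of [2 e^(abc y1 t) / D (ab)] and
    [\sum_(i < a) (-1)^i q^(bci) 2 e^((abc y2 + bci) t) / D (ac)].  As [a] is odd, the
    alternating geometric sum in [q^(bc) e^(bc t)] equals [D (abc) / D (bc)], so the
    generating function is
    [4 e^(abc (y1 + y2) t) D (abc) / (D (ab) D (ac) D (bc))],
    which is symmetric in [a], [b], [c]. *)

(* A copy of [nat -> A] under a new name, so that its product is the convolution
   product and not the pointwise one. *)
Definition fps (A : comUnitRingType) : Type := nat -> A.

(** * The ring of formal power series *)

Section FpsRing.
Variable A : comUnitRingType.
Implicit Types a b c : fps A.

HB.instance Definition _ := gen_eqMixin (fps A).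
HB.instance Definition _ := gen_choiceMixin (fps A).

Let addA : associative (fps_add (A := A) : fps A -> fps A -> fps A).
Proof. by move=> a b c; apply/funext => n; apply: addrA. Qed.
Let addC : commutative (fps_add (A := A) : fps A -> fps A -> fps A).
Proof. by move=> a b; apply/funext => n; apply: addrC. Qed.
Let add0 : left_id ((fun=> 0) : fps A) (fps_add (A := A)).
Proof. by move=> a; apply/funext => n; apply: add0r. Qed.
Let addN : left_inverse ((fun=> 0) : fps A) (fun a n => - a n) (fps_add (A := A)).
Proof. by move=> a; apply/funext => n; apply: addNr. Qed.

HB.instance Definition _ := GRing.isZmodule.Build (fps A) addA addC add0 addN.

Let mulA : associative (fps_mul (A := A) : fps A -> fps A -> fps A).
Proof. by move=> a b c; apply/funext => n; apply: fps_mulA. Qed.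
Let mulC : commutative (fps_mul (A := A) : fps A -> fps A -> fps A).
Proof. by move=> a b; apply/funext => n; apply: fps_mulC. Qed.
Let mul1 : left_id (fps_const 1 : fps A) (fps_mul (A := A)).
Proof. by move=> a; apply/funext => n; apply: fps_mul1. Qed.
Let mulDl :
  left_distributive (fps_mul (A := A) : fps A -> fps A -> fps A) +%R.
Proof.
move=> a b c; apply/funext => n; rewrite -[RHS]big_split /=.
by apply: eq_bigr => i _; apply: mulrDl.
Qed.
Let one_neq0 : (fps_const 1 : fps A) != 0.
Proof. by apply/eqP => /(congr1 (@^~ 0%N)) /eqP; rewrite /= oner_eq0. Qed.

HB.instance Definition _ :=
  GRing.Zmodule_isComNzRing.Build (fps A) mulA mulC mul1 mulDl one_neq0.

Lemma coef_fpsD a b n : (a + b) n = a n + b n. Proof. by []. Qed.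

Lemma coef_fps_sum (I : Type) (r : seq I) (P : pred I) (F : I -> fps A) n :
  (\sum_(i <- r | P i) F i) n = \sum_(i <- r | P i) F i n.
Proof. by apply: (big_morph (fun a : fps A => a n)). Qed.

Definition fpsC (x : A) : fps A := fps_const x.
Definition fpsE (x : A) : fps A := fps_exp x.

Lemma coef_fpsCM (x : A) a n : (fpsC x * a) n = x * a n.
Proof.
rewrite -[LHS]/(fps_mul _ _ n) /fps_mul big_ord_recl /= subn0 big1 ?addr0 //.
by move=> i _; rewrite mul0r.
Qed.

Lemma fpsCM (x y : A) : fpsC (x * y) = fpsC x * fpsC y.
Proof.
by apply/funext => n; rewrite coef_fpsCM; case: n => //= n; rewrite mulr0.
Qed.

Lemma fpsCX (x : A) n : fpsC (x ^+ n) = fpsC x ^+ n.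
Proof. by elim: n => // n IHn; rewrite !exprS fpsCM IHn. Qed.

Lemma fps_mulI a : a 0%N \is a GRing.unit -> injective (fun b => a * b).
Proof.
move=> a0U b c /(congr1 (fun d : fps A => (fps_inv a : fps A) * d)).
rewrite !mulrA (_ : (fps_inv a : fps A) * a = 1) ?mul1r //.
by apply/funext => n; apply: fps_mulV.
Qed.

(* The substitution [t := s t]. *)
Definition fps_scale (s : A) a : fps A := fun n => s ^+ n * a n.

Lemma fps_scaleM s a b : fps_scale s (a * b) = fps_scale s a * fps_scale s b.
Proof.
apply/funext => n; rewrite /fps_scale -[(a * b) n]/(fps_mul a b n).
rewrite /fps_mul mulr_sumr; apply: eq_bigr => i _.
by rewrite -{1}(subnKC (leq_ord i)) exprD mulrACA.
Qed.

Lemma fps_scaleD s a b : fps_scale s (a + b) = fps_scale s a + fps_scale s b.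
Proof. by apply/funext => n; apply: mulrDr. Qed.

Lemma fps_scaleC s x : fps_scale s (fpsC x) = fpsC x.
Proof. by apply/funext => -[|n]; rewrite /fps_scale ?mul1r //= mulr0. Qed.

Lemma fps_scaleE s x : fps_scale s (fpsE x) = fpsE (s * x).
Proof. by apply/funext => n; rewrite /fps_scale /fpsE /fps_exp mulrA exprMn. Qed.

End FpsRing.

(** * Coefficientwise action of a ring morphism *)

Section FpsMorphism.
Variables (A B : comUnitRingType) (f : {rmorphism A -> B}).

Lemma rmorph_fps_mul (a b : nat -> A) n :
  f (fps_mul a b n) = fps_mul (f \o a) (f \o b) n.
Proof. by rewrite rmorph_sum; apply: eq_bigr => i _; rewrite rmorphM. Qed.

Lemma rmorph_fps_const x n : f (fps_const x n) = fps_const (f x) n.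
Proof. by case: n => //= n; rewrite rmorph0. Qed.

Lemma rmorph_fps_exp x n : (n`!%:R : A) \is a GRing.unit ->
  f (fps_exp x n) = fps_exp (f x) n.
Proof. by move=> nU; rewrite /fps_exp rmorphM rmorphXn rmorphV // rmorph_nat. Qed.

End FpsMorphism.

(** * Generating functions over a field of characteristic 0 *)

Section EulerSeries.
Variable K : fieldType.
Hypothesis K0 : forall m, (m.+1%:R : K) != 0.
Implicit Types (q r s x y : K) (a b c m n : nat).

Lemma fact_neq0 n : (n`!%:R : K) != 0.
Proof. by rewrite -(prednK (fact_gt0 n)). Qed.

Lemma polyfact_unit n : (n`!%:R : {poly K}) \is a GRing.unit.
Proof.
by rewrite poly_unitE -polyC_natr size_polyC coefC eqxx unitfE !fact_neq0.
Qed.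

Lemma bin_div_fact n k : (k <= n)%N ->
  'C(n, k)%:R / n`!%:R = (k`!%:R * (n - k)`!%:R)^-1 :> K.
Proof.
move=> le_kn; rewrite -(bin_fact le_kn) !natrM.
have Cn0 : 'C(n, k)%:R != 0 :> K.
  by rewrite -(prednK (_ : 0 < 'C(n, k))%N) ?bin_gt0.
by rewrite invfM mulrA mulfV ?mul1r.
Qed.

Lemma fpsED x y : fpsE (x + y) = fpsE x * fpsE y.
Proof.
apply/funext => n; rewrite -[RHS]/(fps_mul _ _ n) /fps_mul /fpsE /fps_exp.
(* After [addrC] the binomial expansion gives [x] the exponent [i], as in the convolution. *)
rewrite addrC exprDn mulr_suml; apply: eq_bigr => i _.
rewrite -[_ *+ 'C(n, i)]mulr_natr -[LHS]mulrA bin_div_fact ?leq_ord // invfM.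
ring.
Qed.

Lemma fpsE_natmul x n : fpsE (x *+ n) = fpsE x ^+ n.
Proof.
elim: n => [|n IHn]; last by rewrite mulrS exprS fpsED IHn.
by apply/funext => -[|n]; rewrite /fpsE /fps_exp ?divr1 // expr0n mul0r.
Qed.

(** The [D m] of the overview is [euler_den (q ^+ m) m%:R]. *)
Definition euler_den r s : fps K := fpsC r * fpsE s + 1.

Definition euler_series r x : fps K := fun n => (euler_poly n r).[x] / n`!%:R.

Lemma euler_den_unit r s : r + 1 != 0 -> euler_den r s 0%N \is a GRing.unit.
Proof.
move=> r1; rewrite unitfE /euler_den coef_fpsD coef_fpsCM /fpsE /fps_exp.
by rewrite expr0 divr1 mulr1.
Qed.

(** Evaluation at [x] is a ring morphism from [{poly K}] to [K], so it carries the identity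
    [euler_gfP] to this one. *)
Lemma euler_den_series r x : r + 1 != 0 ->
  euler_den r 1 * euler_series r x = fpsC 2 * fpsE x.
Proof.
move=> r1; apply/funext => n.
rewrite -[LHS]/(fps_mul _ _ n) -[RHS]/(fps_mul _ _ n).
have := congr1 (horner_eval x) (euler_gfP n K0 r1).
rewrite !rmorph_fps_mul => E; etransitivity; last (etransitivity; first exact: E).
- apply: eq_fps_mul => i /=.
    rewrite rmorphD rmorph_fps_mul; congr (_ + _); last first.
      by rewrite rmorph_fps_const rmorph1.
    apply: eq_fps_mul => j /=.
      by rewrite rmorph_fps_const /= /horner_eval hornerC.
    by rewrite rmorph_fps_exp ?polyfact_unit // rmorph1.
  by rewrite rmorphM rmorphV ?polyfact_unit // rmorph_nat.
- apply: eq_fps_mul => i /=; first by rewrite rmorph_fps_const rmorph_nat.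
  by rewrite rmorph_fps_exp ?polyfact_unit //= /horner_eval hornerX.
Qed.

Lemma euler_den_scale_series r s x : r + 1 != 0 ->
  euler_den r s * fps_scale s (euler_series r x) = fpsC 2 * fpsE (s * x).
Proof.
move=> r1; rewrite -fps_scaleE -(fps_scaleC s 2) -fps_scaleM -(euler_den_series x r1).
rewrite fps_scaleM fps_scaleD fps_scaleM fps_scaleE mulr1 fps_scaleC.
by rewrite -[1 in RHS]/(fpsC 1) fps_scaleC.
Qed.

(** The scalings absorb the prefactor: [a ^+ n] splits as [a ^+ k * a ^+ (n - k)], which turns the
    weights [b ^+ k] and [c ^+ (n - k)] into powers of [a * b] and [a * c]. *)
Definition euler_sum_gf q a b c y1 y2 : fps K :=
  fps_scale (a * b)%:R (euler_series (q ^+ (a * b)) (c%:R * y1))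
  * \sum_(i < a) fpsC ((-1) ^+ i * q ^+ (b * c * i))
      * fps_scale (a * c)%:R
          (euler_series (q ^+ (a * c)) (b%:R * y2 + b%:R / a%:R * i%:R)).

Lemma euler_sumE q n a b c y1 y2 :
  euler_sum q n a b c y1 y2 = n`!%:R * euler_sum_gf q a b c y1 y2 n.
Proof.
rewrite -[euler_sum_gf _ _ _ _ _ _ n]/(fps_mul _ _ n) /fps_mul /euler_sum !mulr_sumr.
apply: eq_bigr => k _; rewrite coef_fps_sum !mulr_sumr.
apply: eq_bigr => i _; rewrite coef_fpsCM /fps_scale /euler_series.
have -> : 'C(n, k)%:R = n`!%:R / k`!%:R / (n - k)`!%:R :> K.
  by rewrite -mulrA -invfM -bin_div_fact ?leq_ord // mulrCA mulfV ?fact_neq0 ?mulr1.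
rewrite !natrM !exprMn -{1}(subnKC (leq_ord k)) exprD.
ring.
Qed.

Lemma euler_den_geometric q a m : odd a ->
  euler_den (q ^+ m) m%:R
    * (\sum_(i < a) fpsC ((-1) ^+ i * q ^+ (m * i)) * fpsE (m * i)%:R)
  = euler_den (q ^+ (m * a)) (m * a)%:R.
Proof.
move=> a_odd; set u := fpsC (q ^+ m) * fpsE m%:R.
have uX i : u ^+ i = fpsC (q ^+ (m * i)) * fpsE (m * i)%:R.
  by rewrite exprMn -fpsCX -exprM -fpsE_natmul natrM mulr_natr.
rewrite {2}/euler_den -uX /euler_den -/u.
(* The goal is now [(u + 1) * S = u ^+ a + 1], where [S] is a geometric sum of ratio [- u]. *)
rewrite (eq_bigr (fun i : 'I_a => (- u) ^+ i)); last first.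
  move=> i _; rewrite fpsCM -mulrA -uX [RHS]exprNn; congr (_ * _).
  rewrite fpsCX; congr (_ ^+ _).
  by apply/funext => -[|k] //; rewrite -[RHS]/(- 0) oppr0.
(* Oddness of [a] gives [(- u) ^+ a = - u ^+ a]; negating both sides then yields the claim. *)
have := subrX1 (- u) a; rewrite exprNn -signr_odd a_odd expr1 => E.
by apply: oppr_inj; rewrite -mulNr !opprD -E mulN1r.
Qed.

Lemma euler_sum_gf_den q a b c y1 y2 : odd a ->
  (forall m, q ^+ m + 1 != 0) ->
  euler_den (q ^+ (a * b)) (a * b)%:R * euler_den (q ^+ (a * c)) (a * c)%:R
    * euler_den (q ^+ (b * c)) (b * c)%:R * euler_sum_gf q a b c y1 y2
  = fpsC 2 * fpsC 2 * fpsE ((a * b * c)%:R * (y1 + y2))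
    * euler_den (q ^+ (a * b * c)) (a * b * c)%:R.
Proof.
move=> a_odd q1.
have a0 : a%:R != 0 :> K by case: a a_odd.
(* This order lets the geometric sum apply with [m := b * c]; it rewrites [D (abc)] as [D3 * S3]. *)
rewrite (_ : (a * b * c = b * c * a)%N); last by rewrite -mulnA mulnC.
rewrite -(euler_den_geometric q (b * c) a_odd) /euler_sum_gf.
set D1 := euler_den (q ^+ (a * b)) _; set D2 := euler_den (q ^+ (a * c)) _.
set D3 := euler_den (q ^+ (b * c)) _; set S1 := fps_scale _ _.
set S2 := \sum_(i < a) _; set S3 := \sum_(i < a) _.
have E1 : D1 * S1 = fpsC 2 * fpsE ((b * c * a)%:R * y1).
  rewrite euler_den_scale_series // mulrA -natrM.
  by congr (_ * fpsE (_%:R * _)); rewrite -mulnA mulnC.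
have E2 : D2 * S2 = fpsC 2 * fpsE ((b * c * a)%:R * y2) * S3.
  rewrite !mulr_sumr; apply: eq_bigr => i _.
  rewrite mulrCA euler_den_scale_series //.
  (* Scaling by [a * c] clears the denominator [a]: the shift [b i / a] becomes the exponent [b c i]
     of the geometric sum. *)
  have -> : (a * c)%:R * (b%:R * y2 + b%:R / a%:R * i%:R)
      = (b * c * a)%:R * y2 + (b * c * i)%:R :> K.
    by rewrite !natrM; field.
  rewrite fpsED; ring.
rewrite [_%:R * (y1 + y2)]mulrDr fpsED.
transitivity (D3 * (D1 * S1) * (D2 * S2)); first by ring.
rewrite E1 E2; ring.
Qed.

(** Each factor has constant term [q ^+ j + 1], a unit, so it can be cancelled. *)
Lemma euler_den3I q k l m : (forall m, q ^+ m + 1 != 0) ->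
  injective (fun f => euler_den (q ^+ k) k%:R * euler_den (q ^+ l) l%:R
                      * euler_den (q ^+ m) m%:R * f).
Proof.
move=> q1 f g /=; rewrite -!mulrA.
by do 3 move/(fps_mulI (euler_den_unit _ (q1 _))).
Qed.

(** Exchanging [b] and [c] only permutes the three denominators and keeps [a * b * c], so
    [euler_sum_gf_den] gives the same product for both series. *)
Lemma euler_sum_gf_swap23 q a b c y1 y2 : odd a ->
  (forall m, q ^+ m + 1 != 0) ->
  euler_sum_gf q a b c y1 y2 = euler_sum_gf q a c b y1 y2.
Proof.
move=> a_odd q1; apply: (@euler_den3I q (a * b) (a * c) (b * c)) => //=.
rewrite euler_sum_gf_den // (mulrC (euler_den _ (a * b)%:R)) (mulnC b c).
by rewrite euler_sum_gf_den // (mulnAC a c b).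
Qed.

Lemma euler_sum_gf_swap12 q a b c y1 y2 : odd a -> odd b ->
  (forall m, q ^+ m + 1 != 0) ->
  euler_sum_gf q a b c y1 y2 = euler_sum_gf q b a c y1 y2.
Proof.
move=> a_odd b_odd q1; apply: (@euler_den3I q (a * b) (a * c) (b * c)) => //=.
rewrite euler_sum_gf_den // (mulrAC (euler_den _ (a * b)%:R)) (mulnC a b).
by rewrite euler_sum_gf_den.
Qed.

End EulerSeries.

(** * The p-adic estimate and the conclusion *)

Lemma Cp_exprD1_neq0 (R : realType) (p : nat) (C : padicComplex R p) (q : Cp C) m :
  prime p -> odd p -> absCp (q - 1) < 1 -> q ^+ m + 1 != 0.
Proof.
(* It remains to keep [q ^+ m] in the open unit disc around 1, by induction on [m] with the
   ultrametric inequality and [absCp q <= 1]. *)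
move=> p_pr p_odd hq; apply: Cp_add1_neq0 p_pr p_odd _.
have [ge0 abs0 absM absD] := absCpP C.
have abs1 : absCp (1 : Cp C) = 1.
  have /mulfI : absCp (1 : Cp C) != 0.
    by apply/eqP => /abs0/eqP; rewrite oner_eq0.
  by apply; rewrite -absM !mulr1.
have le1 : absCp q <= 1.
  rewrite -(subrK 1 q); apply: le_trans (absD _ _) _.
  by rewrite ge_max abs1 (ltW hq) lexx.
elim: m => [|m IHm]; first by rewrite expr0 subrr (proj2 (abs0 0)).
have -> : q ^+ m.+1 - 1 = q * (q ^+ m - 1) + (q - 1) by rewrite exprS; ring.
apply: le_lt_trans (absD _ _) _; rewrite gt_max hq andbT absM.
by apply: le_lt_trans IHm; rewrite ler_piMl.
Qed.

Theorem theorem4p5 (R : realType) (p : nat) (p_pr : prime p) (p_odd : odd p)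
    (C : padicComplex R p) (q : Cp C)
    (hq : absCp (q - 1) < p%:R `^ (- (p%:R - 1)^-1))
    (w1 w2 w3 : nat) (hw1 : odd w1) (hw2 : odd w2) (hw3 : odd w3)
    (n : nat) (y1 y2 : Cp C) (hy1 : in_Zp y1) (hy2 : in_Zp y2) :
  [/\ euler_sum q n w1 w2 w3 y1 y2 = euler_sum q n w1 w3 w2 y1 y2,
      euler_sum q n w1 w3 w2 y1 y2 = euler_sum q n w2 w1 w3 y1 y2,
      euler_sum q n w2 w1 w3 y1 y2 = euler_sum q n w2 w3 w1 y1 y2,
      euler_sum q n w2 w3 w1 y1 y2 = euler_sum q n w3 w1 w2 y1 y2
    & euler_sum q n w3 w1 w2 y1 y2 = euler_sum q n w3 w2 w1 y1 y2].
Proof.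
have p_gt1 : 1 < p%:R :> R by rewrite ltr1n prime_gt1.
have q_lt1 : absCp (q - 1) < 1.
  (* The exponent is nonpositive and the base exceeds 1, so the radius is at most 1. *)
  apply: lt_le_trans hq _; rewrite -[leRHS](powRr0 p%:R) ler_powR ?(ltW p_gt1) //.
  by rewrite oppr_le0 invr_ge0 subr_ge0 (ltW p_gt1).
have K0 m : (m.+1%:R : Cp C) != 0 by apply: Cp_pchar0.
have q1 m : q ^+ m + 1 != 0 by apply: Cp_exprD1_neq0.
have swap23 a b c (ha : odd a) := euler_sum_gf_swap23 K0 b c y1 y2 ha q1.
have swap12 a b c (ha : odd a) (hb : odd b) :=
  euler_sum_gf_swap12 K0 c y1 y2 ha hb q1.
(* The six sums are the six orderings of the weights; adjacent transpositions link each to the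
   next. *)
rewrite !(euler_sumE K0); split; congr (_ * _ n).
- exact: swap23.
- by rewrite swap23 // swap12.
- exact: swap23.
- by rewrite swap12 // swap23.
- exact: swap23.
Qed.
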